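(* Let $k<n$ be positive integers with $1<\frac nk<2$, and consider an $(n,k)$ MDS-coded storage system operated with batch sampling and exponential service times of mean $1$, as described in the context. Let $\hat Q_{(1)}(n,k)\le\hat Q_{(2)}(n,k)\le\dots\le\hat Q_{(k)}(n,k)$ be the order statistics of the queue lengths $\hat Q_1(n,k),\dots,\hat Q_k(n,k)$ of the $k$ servers to which a request is forwarded, and let $H(k)=\sum_{i=1}^k\frac1i$. Then the mean file access delay satisfies $$\bar W(n,k)\le H(k)+\sum_{l=1}^{k}\frac{1}{k-l+1}\,\mathbb{E}\big[\hat Q_{(l)}(n,k)\big]\le H(k)+\sum_{l=1}^{k}\mathbb{E}\big[\hat Q_{(l)}(n,k)\big].$$
   Context: System: each file is divided into $k$ parts and encoded by an $(n,k)$ MDS code into $n$ chunks stored in $n$ distinct servers; any $k$ of the $n$ chunks suffice to recover the file. There are $L$ servers with infinite-capacity queues. File requests, each a batch of $k$ tasks, arrive as a Poisson process of rate $\lambda L/k$, $\lambda\in(0,1)$, each for a uniformly random file. Batch sampling: an arriving request probes the $n$ servers holding the requested file and sends its $k$ tasks to the $k$ distinct least-loaded (shortest-queue) ones among them, one task each. The read is complete when all $k$ tasks are complete. In the steady state of the large system limit, $\hat Q_i(n,k)$, $i=1,\dots,k$, denote the queue lengths of the $k$ selected servers; they are nonnegative-integer-valued random variables with finite means. The service times $X_c^{(j,i)}$ (job $j$ of queue $i$) are i.i.d. exponential with mean $1$ over all $i,j$ and independent of the queue lengths. By memorylessness, the mean file access delay is $$\bar W(n,k)=\mathbb{E}\Big[\max_{1\le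 i\le k}\sum_{j=1}^{\hat Q_i(n,k)+1}X_c^{(j,i)}\Big].$$ *)

(* Defs.v *)
From mathcomp Require Import all_boot all_order all_algebra.
From mathcomp Require Import finmap.
From mathcomp Require Import all_classical all_reals all_analysis.

Set Implicit Arguments.
Unset Strict Implicit.
Unset Printing Implicit Defensive.

Import Order.TTheory GRing.Theory Num.Theory.
Import numFieldNormedType.Exports.

Local Open Scope classical_set_scope.
Local Open Scope ring_scope.

(** * Coded storage with batch sampling *)

(* The queue lengths at the [L] servers. *)
Definition state (L : nat) := {ffun 'I_L -> nat}.

(* [s i] is the server that receives task [i] of a request for a file whose
   chunks are on the servers [A]. *)
Definition least_loaded (k L : nat) (q : state L) (A : {set 'I_L})
    (s : {ffun 'I_k -> 'I_L}) : bool :=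
  [&& injectiveb s, [forall i, s i \in A] &
      [forall j in A, (j \notin codom s) ==> [forall i, (q (s i) <= q j)%N]]].

(* [place f] is the set of the [n] servers holding the chunks of [f]; since any
   [k] chunks of an (n,k) MDS code recover the file, the [k] tasks may go to any
   [k] of these servers. [dispatch q f] is a probability on assignments, so that
   ties between equally loaded servers, and the labelling of the [k] selected
   servers, may be resolved by any (random) rule. *)
Record batch_sampling (R : realType) (n k L : nat) := BatchSampling {
  file : finType ;
  file_gt0 : (0 < #|file|)%N ;
  place : file -> {set 'I_L} ;
  card_place : forall f, #|place f| = n ;
  dispatch : state L -> file -> {ffun 'I_k -> 'I_L} -> R ;
  dispatch_ge0 : forall q f s, 0 <= dispatch q f s ;
  dispatch_sum1 : forall q f, \sum_s dispatch q f s = 1 ;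
  dispatch_least_loaded : forall q f s,
    dispatch q f s != 0 -> least_loaded q (place f) s }.

(* Probability that a request arriving in state [q] is assigned according to
   [s], the requested file being uniformly random. *)
Definition assign (R : realType) (n k L : nat) (S : batch_sampling R n k L)
    (q : state L) (s : {ffun 'I_k -> 'I_L}) : R :=
  \sum_(f : file S) #|file S|%:R^-1 * dispatch q f s.

Definition after_arrival (k L : nat) (q : state L) (s : {ffun 'I_k -> 'I_L})
  : state L := [ffun j => (q j + (j \in codom s))%N].

Definition after_departure (L : nat) (q : state L) (j : 'I_L) : state L :=
  [ffun j' => (q j' - (j' == j))%N].

(* Jump rates of the Markov process of queue lengths: requests arrive at rate
   [lambda * L / k], and every nonempty queue is served at rate 1. *)
Definition rate (R : realType) (n k L : nat) (S : batch_sampling R n k L)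
    (lambda : R) (q q' : state L) : R :=
  \sum_(s : {ffun 'I_k -> 'I_L} | q' == after_arrival q s)
     lambda * L%:R / k%:R * assign S q s
  + \sum_(j : 'I_L | (0 < q j)%N && (q' == after_departure q j)) 1.

(* Global balance equations; for [0 < k] there is no jump from [q] to [q], and
   the jump rates out of a state are bounded, so they characterize the
   stationary distributions. *)
Definition stationary (R : realType) (n k L : nat) (S : batch_sampling R n k L)
    (lambda : R) (p : state L -> R) : Prop :=
  [/\ forall q, 0 <= p q,
      \esum_(q in [set: state L]) (p q)%:E = 1%E &
      forall q, \esum_(q' in [set: state L]) (p q' * rate S lambda q' q)%:E
              = \esum_(q' in [set: state L]) (p q * rate S lambda q q')%:E].

(* Law of the queue lengths found by a request at the [k] servers it is
   forwarded to, when it arrives in a state of law [p]. *)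
Definition selected_law (R : realType) (n k L : nat)
    (S : batch_sampling R n k L) (p : state L -> R) (v : {ffun 'I_k -> nat})
  : \bar R :=
  \esum_(q in [set: state L])
     (\sum_(s : {ffun 'I_k -> 'I_L} | [forall i, q (s i) == v i])
        p q * assign S q s)%:E.

(* [Q] has the limiting law, as the number of servers grows, of the queue
   lengths selected by an arriving request in steady state. The [m]-th system
   has [n + m] servers, as at least [n] are needed to place a file. Convergence
   of the point masses is convergence in law, the limit being a probability. *)
Definition large_system_steady_state (R : realType) (n k : nat) (lambda : R)
    (S : forall m : nat, batch_sampling R n k (n + m))
    (d : measure_display) (T : measurableType d) (P : probability T R)
    (Q : 'I_k -> {RV P >-> nat}) : Prop :=
  exists2 p : forall m : nat, state (n + m) -> R,
    forall m, stationary (S m) lambda (p m) &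
    forall v : {ffun 'I_k -> nat},
      (fun m => selected_law (S m) (p m) v) @ \oo -->
      P [set w | forall i, Q i w = v i].

(** * Independence *)

Definition mutually_independent (R : realType) (d d' : measure_display)
    (T : measurableType d) (T' : measurableType d') (P : probability T R)
    (I : choiceType) (X : I -> {RV P >-> T'}) : Prop :=
  forall (J : {fset I}) (B : I -> set T'), (forall i, measurable (B i)) ->
    P (\bigcap_(i in [set` J]) X i @^-1` B i)
    = (\prod_(i <- J) P (X i @^-1` B i))%E.

(* The family [X], as a whole, is independent of the family [Y]. *)
Definition independent_families (R : realType) (d d1 d2 : measure_display)
    (T : measurableType d) (T1 : measurableType d1) (T2 : measurableType d2)
    (P : probability T R) (I1 I2 : choiceType)
    (X : I1 -> {RV P >-> T1}) (Y : I2 -> {RV P >-> T2}) : Prop :=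
  forall (J1 : {fset I1}) (J2 : {fset I2}) (A : I1 -> set T1) (B : I2 -> set T2),
    (forall i, measurable (A i)) -> (forall i, measurable (B i)) ->
    (P ((\bigcap_(i in [set` J1]) X i @^-1` A i) `&`
        (\bigcap_(i in [set` J2]) Y i @^-1` B i))
     = P (\bigcap_(i in [set` J1]) X i @^-1` A i) *
       P (\bigcap_(i in [set` J2]) Y i @^-1` B i))%E.

(** * Delay *)

(* [X (j, i)] is the service time of job [j.+1] of queue [i]; the maximum is
   taken in the extended reals, so that it needs no default value. *)
Definition mean_access_delay (R : realType) (k : nat) (d : measure_display)
    (T : measurableType d) (P : probability T R)
    (Q : 'I_k -> {RV P >-> nat}) (X : nat * 'I_k -> {RV P >-> R}) : \bar R :=
  (\int[P]_w \big[maxe/-oo]_(i < k)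
     (\sum_(0 <= j < (Q i w).+1) X (j, i) w)%:E)%E.

(* The [l]-th smallest value of [q], for [1 <= l <= k]. *)
Definition order_stat (k : nat) (q : 'I_k -> nat) (l : nat) : nat :=
  nth 0%N (sort leq [seq q i | i <- enum 'I_k]) l.-1.

Definition harmonic_number (R : realType) (k : nat) : R :=
  \sum_(1 <= i < k.+1) i%:R^-1.

(* Main.v *)
Require Import Defs.
From mathcomp Require Import all_boot all_order all_algebra.
From mathcomp Require Import finmap.
From mathcomp Require Import all_classical all_reals all_analysis.
From mathcomp Require Import measurable_realfun zify.

Import Order.TTheory GRing.Theory Num.Theory.
Import numFieldNormedType.Exports.

Local Open Scope classical_set_scope.
Local Open Scope ring_scope.

(** Number the jobs of each queue from [0], so that the job [Q_i] of queue [i] is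
    the new task. Waiting, for each [j], until all jobs of rank [j] are served
    before serving any job of rank [j + 1] only increases the delay, which is thus
    at most [\sum_j M_j], where [M_j] is the largest of the service times of the
    jobs of rank [j]. Given that [c_j] queues have such a job, [M_j] is the maximum
    of [c_j] i.i.d. exponentials, of mean [H(c_j)]. Finally, the term
    [1 / (k - l + 1)] of [H(c_j)] is present when at least [k - l + 1] queues have
    a job of rank [j], i.e. when [j <= Q_(l)]; hence, exchanging the sums,
    [\sum_j H(c_j) = H(k) + \sum_l Q_(l) / (k - l + 1)]. *)

(** * The exponential law: distribution function and integrals *)

Lemma exponential_prob1_le (R : realType) (t : R) : 0 <= t ->
  exponential_prob 1 `]-oo, t] = (1 - expR (- t))%:E.
Proof.
move=> t0.
have -> : exponential_prob 1 `]-oo, t] = exponential_prob 1 `[0, t].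
  rewrite /exponential_prob integral_mkcond [RHS]integral_mkcond.
  apply: eq_integral => x _; rewrite !patchE.
  have [x0|x0] := ltP x 0.
    by rewrite lt0_exponential_pdf// !if_same.
  congr (if _ then _ else _).
  by apply/idP/idP; rewrite !inE/= !in_itv/= ?x0// => /andP[].
(* The formula for the mass of [[0, t]] is for [t > 0]; at [0] the interval is a single point, of
   mass zero. *)
have [->|t_neq0] := eqVneq t 0.
  by rewrite oppr0 expR0 subrr /exponential_prob set_itv1 integral_set1.
by rewrite exponential_prob_itv0c ?mulN1r ?lt_neqAle 1?eq_sym ?t_neq0.
Qed.

Section exponential_integrals.
Context {R : realType}.
Notation mu := (@lebesgue_measure R).

Lemma continuous_expRN : continuous (fun t : R => expR (- t)).
Proof.
by move=> t; apply: continuous_comp; [exact: opp_continuous|exact: continuous_expR].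
Qed.

Lemma continuous_1subexpRX (n : nat) : continuous (fun t : R => (1 - expR (- t)) ^+ n).
Proof.
move=> t.
apply: (@continuous_comp _ _ _ (fun t : R => 1 - expR (- t)) (fun y => y ^+ n)).
  by apply: cvgB; [exact: cvg_cst|exact: continuous_expRN].
exact: exprn_continuous.
Qed.

(** The integrand has the antiderivative [G t = (1 - e^(-t))^(m+1) / (m+1)], which goes from [0] at
    [t = 0] to [1 / (m+1)] at infinity. *)
Lemma integral_expRN_1subX (m : nat) :
  (\int[mu]_(t in `[0%R, +oo[) (expR (- t) * (1 - expR (- t)) ^+ m)%:E
   = (m.+1%:R^-1)%:E)%E.
Proof.
pose G (t : R) := m.+1%:R^-1 * (1 - expR (- t)) ^+ m.+1.
pose f (t : R) := expR (- t) * (1 - expR (- t)) ^+ m.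
have cG : continuous G by move=> t; apply: cvgM; [exact: cvg_cst|exact: continuous_1subexpRX].
have dG (t : R) : is_derive t 1 G (f t).
  have d1 : is_derive t 1 (cst 1 - (expR \o -%R)) (0 - expR (- t) * - 1).
    by apply: is_deriveB.
  have -> : G = m.+1%:R^-1 \*: ((cst 1 - (expR \o -%R)) ^+ m.+1).
    by apply/funext => x; rewrite /G /= fctE.
  apply: (is_derive_eq (is_deriveZ m.+1%:R^-1 (is_deriveX m.+1 d1))).
  rewrite mulrN1 sub0r opprK /GRing.scale/= !mulrA.
  by rewrite mulVf ?pnatr_eq0// mul1r mulrC.
rewrite (@ge0_continuous_FTC2y _ f G 0 (m.+1%:R^-1)).
- by rewrite /G oppr0 expR0 subrr expr0n/= mulr0 sube0.
- move=> t t0; rewrite /f mulr_ge0 ?expR_ge0// exprn_ge0// subr_ge0.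
  by rewrite -expR0 ler_expR lerNl oppr0.
- apply: continuous_subspaceT => t.
  by apply: cvgM; [exact: continuous_expRN|exact: continuous_1subexpRX].
- have c1 : (1 - expR (- t)) @[t --> +oo] --> (1 : R).
    by rewrite -[1 in X in _ --> X]subr0; apply: cvgB; [exact: cvg_cst|exact: cvgr_expR].
  have : G t @[t --> +oo] --> (m.+1%:R^-1 * 1 ^+ m.+1 : R).
    apply: cvgM; first exact: cvg_cst.
    apply: (@cvg_comp _ _ _ _ (fun y : R => y ^+ m.+1) _ _ _ c1); exact: exprn_continuous.
  by rewrite expr1n mulr1.
- by move=> t _; exact: ex_derive.
- exact/cvg_at_right_filter/cG.
- by move=> t _; rewrite derive1E; exact: derive_val.
Qed.

(** The integrand is the tail of the maximum of [m] i.i.d. exponentials, so this is the mean of that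
    maximum. Factoring [1 - y^m] with [1 - y = e^(-t)] gives a geometric sum whose term of index [r]
    integrates to [1 / (r+1)]. *)
Lemma integral_1sub_1subX (m : nat) :
  (\int[mu]_(t in `[0%R, +oo[) (1 - (1 - expR (- t)) ^+ m)%:E
   = (harmonic_number R m)%:E)%E.
Proof.
have fE (t : R) : 1 - (1 - expR (- t)) ^+ m =
    \sum_(r < m) expR (- t) * (1 - expR (- t)) ^+ r.
  rewrite -mulr_sumr -[X in X - _](expr1n _ m) subrXX.
  rewrite opprB addrCA subrr addr0; congr (_ * _).
  by apply: eq_bigr => r _; rewrite expr1n mul1r.
under eq_integral do rewrite fE -sumEFin.
rewrite ge0_integral_sum//=; last 2 first.
- move=> r; apply/measurable_EFinP; apply: measurable_funTS.
  apply: continuous_measurable_fun => t.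
  by apply: cvgM; [exact: continuous_expRN|exact: continuous_1subexpRX].
- move=> r t /=; rewrite in_itv/= andbT => t0.
  by rewrite lee_fin mulr_ge0 ?expR_ge0// exprn_ge0// subr_ge0 expR_le1 lerNl oppr0.
under eq_bigr do rewrite integral_expRN_1subX.
by rewrite sumEFin /harmonic_number big_add1/= big_mkord.
Qed.
End exponential_integrals.

(** * Tools on integrals and measurability *)

Lemma integral_le_ge0 {d} {T : measurableType d} {R : realType}
    (mu : {measure set T -> \bar R}) (f g : T -> \bar R) :
  (forall x, 0 <= g x)%E -> (forall x, f x <= g x)%E ->
  (\int[mu]_x f x <= \int[mu]_x g x)%E.
Proof.
(* The integral of [f] is at most that of its positive part, and simple functions below this part
   are below [g]. Arguing on these suprema covers the integrand of the delay, which can be negative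
   and is not shown measurable. *)
move=> g0 fg; rewrite [leRHS]ge0_integralTE// integralE.
apply: (@le_trans _ _ (\int[mu]_x f^\+ x)%E).
  by rewrite geeDl// oppe_le0; apply: integral_ge0.
rewrite ge0_integralTE//; apply: ereal_sup_le => _ [h hf <-]; exists h => // x.
by rewrite (le_trans (hf x))// unlock ge_max fg g0.
Qed.

(** The vector of queue lengths takes countably many values, so every preimage is a countable union
    of joint level sets, whatever [g] is. *)
Lemma measurable_nat_family {d d'} {T : measurableType d} {T' : measurableType d'}
    (k : nat) (Q : 'I_k -> {mfun T >-> nat}) (g : ('I_k -> nat) -> T') :
  measurable_fun [set: T] (fun w => g (Q^~ w)).
Proof.
move=> _ B _; rewrite setTI.
pose D := [set v : {ffun 'I_k -> nat} | B (g v)].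
have -> : (fun w => g (Q^~ w)) @^-1` B =
    \bigcup_(v in D) \bigcap_(i in [set: 'I_k]) Q i @^-1` [set v i].
  apply/seteqP; split => [w /= Bw|w [v Bv Qv] /=].
    exists [ffun i => Q i w]; last by move=> i _ /=; rewrite ffunE.
    by rewrite /D/= (_ : fun_of_fin _ = Q^~ w)//; apply/funext => i; rewrite ffunE.
  by rewrite (_ : Q^~ w = v)//; apply/funext => i; exact: Qv.
rewrite bigcup_mkcond.
apply: countable_bigcupT_measurable; first exact: countableP.
move=> v; case: ifPn => // _.
apply: fin_bigcap_measurable => // i _.
by rewrite -[X in measurable X]setTI; exact: measurable_funPT.
Qed.

Lemma measurable_bigmaxr {d} {T : measurableType d} {R : realType} (I : Type)
    (r : seq I) (D : {pred I}) (f : I -> T -> R) :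
  (forall i, measurable_fun [set: T] (f i)) ->
  measurable_fun [set: T] (fun x => \big[Num.max/0]_(i <- r | D i) f i x).
Proof.
move=> mf; elim: r => [|i r IH].
  by under eq_fun do rewrite big_nil; exact: measurable_cst.
under eq_fun do rewrite big_cons; case: (D i) => //.
exact: measurable_maxr.
Qed.

(** * Order statistics and harmonic numbers *)

Lemma leq_order_stat (k : nat) (q : 'I_k -> nat) (l j : nat) :
  (0 < l <= k)%N ->
  (j <= order_stat q l)%N = (k - l + 1 <= #|[set i | (j <= q i)%N]%SET|)%N.
Proof.
move=> /andP[l0 lk]; rewrite /order_stat; set s := sort _ _.
have ss : size s = k by rewrite size_sort size_map size_enum_ord.
have sorted_s : sorted <=%O s.
  by have := sort_sorted leq_total [seq q i | i <- enum 'I_k].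
have cge : count (fun x => (j <= x)%N) s = #|[set i | (j <= q i)%N]%SET|.
  rewrite /s count_sort count_map cardsE cardE -size_filter; congr size.
  by rewrite enumT; apply: eq_filter => i; rewrite /= unfold_in.
(* The [k] entries split into those below [j] and those at least [j]; the [l]-th smallest is at
   least [j] exactly when at most [l - 1] entries are below [j]. *)
have ceq : (count (fun x => (x < j)%N) s + #|[set i | (j <= q i)%N]%SET|)%N = k.
  rewrite -cge -[RHS]ss -(count_predC (fun x => (x < j)%N) s); congr addn.
  by apply: eq_count => x /=; rewrite -leqNgt.
have [h|h] := leqP (count (fun x => (x < j)%N) s) l.-1.
  have -> : (j <= nth 0 s l.-1)%N.
    by apply: (@nth_count_ge _ nat); rewrite ?ss// h/= prednK.
  by apply/esym; move: h; rewrite -ltnS prednK//; lia.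
have : (nth 0 s l.-1 < j)%N by exact: (@nth_count_lt _ nat).
rewrite ltnNge => /negPf ->.
by apply/esym/negbTE; rewrite -ltnNge; move: h; rewrite prednK//; lia.
Qed.

(** Reversing the sum by [i = k - l + 1] and turning the bound [c] into an indicator gives all
    [c <= k] the same range of [l], as needed to exchange this sum with the series over ranks. *)
Lemma harmonic_number_widen (R : realType) (k c : nat) : (c <= k)%N ->
  harmonic_number R c =
    \sum_(1 <= l < k.+1) (k - l + 1 <= c)%:R * (k - l + 1)%:R^-1.
Proof.
move=> ck; rewrite /harmonic_number (@big_nat_widen _ _ _ 1 c.+1 k.+1)//.
rewrite [RHS]big_nat_rev [LHS]big_mkcond/=; apply: eq_big_nat => i /andP[i0 ik].
rewrite (_ : (k - _ + 1 = i)%N); last by lia.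
by rewrite ltnS; case: (leqP i c) => _; rewrite ?mul1r ?mul0r.
Qed.

Lemma nneseries_leq (R : realType) (q : nat) :
  (\sum_(j <oo) ((j <= q)%N%:R : R)%:E = q.+1%:R%:E)%E.
Proof.
rewrite (nneseries_split 0 q.+1)//.
rewrite add0n eseries0 ?adde0; last first.
  by move=> j /= qj _; rewrite leqNgt qj.
rewrite sumEFin big_nat (eq_bigr (fun=> 1)).
  by rewrite -big_nat sumr_const_nat subn0.
by move=> j /=; rewrite ltnS => ->.
Qed.

Lemma nneseries_harmonic_number (R : realType) (k : nat) (q : 'I_k -> nat) :
  (\sum_(j <oo) (harmonic_number R #|[set i | (j <= q i)%N]%SET|)%:E
   = (harmonic_number R k)%:E
     + \sum_(1 <= l < k.+1) ((k - l + 1)%:R^-1)%:E * (order_stat q l)%:R%:E)%E.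
Proof.
have -> : harmonic_number R k = \sum_(1 <= l < k.+1) (k - l + 1)%:R^-1.
  rewrite (@harmonic_number_widen R k k)//; apply: eq_big_nat => l lk.
  by rewrite (_ : (_ <= _)%N) ?mul1r//; lia.
rewrite -sumEFin -big_split/=.
under eq_eseriesr => j _.
  rewrite (@harmonic_number_widen R k); last by rewrite -[leqRHS]card_ord max_card.
  rewrite -sumEFin.
over.
rewrite nneseries_sum_nat; last first.
  by move=> j l; rewrite lee_fin mulr_ge0.
apply: eq_big_nat => l lk.
transitivity (((k - l + 1)%:R^-1)%:E * (\sum_(j <oo) ((j <= order_stat q l)%N%:R : R)%:E))%E.
  rewrite -nneseriesZl; last by move=> j _; rewrite lee_fin.
  by apply: eq_eseriesr => j _; rewrite leq_order_stat// EFinM muleC.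
by rewrite nneseries_leq -natr1 EFinD muleDr// mule1 addeC.
Qed.

(** * Maxima of independent exponentials *)

Section exponential_family.
Context {R : realType} {d : measure_display} {T : measurableType d}
  (P : probability T R) {I : choiceType} (X : I -> {RV P >-> R}).
Hypothesis X_exp : forall i (A : set R), measurable A ->
  distribution P (X i) A = exponential_prob 1 A.
Hypothesis X_ind : mutually_independent X.

Lemma probability_exponential_le (J : {fset I}) (t : R) : 0 <= t ->
  P (\bigcap_(i in [set` J]) X i @^-1` `]-oo, t]) =
    ((1 - expR (- t)) ^+ #|` J|)%:E.
Proof.
move=> t0; rewrite (X_ind J (fun=> `]-oo, t]%classic))//.
rewrite (eq_bigr (fun=> (1 - expR (- t))%:E)); last first.
  move=> i _; rewrite -exponential_prob1_le//.
  by rewrite -(X_exp i); [|exact: measurable_itv].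
rewrite prodEFin; congr EFin.
by rewrite big_const_seq count_predT iter_mulr_1.
Qed.

(** The mean of a nonnegative variable is the integral of its tail over [t >= 0]. Independence from
    [E] pulls [P E] out of the tail, leaving the tail of the maximum over [J]. *)
Lemma integral_indic_max_exponential (J : {fset I}) (E : set T) :
  measurable E ->
  (forall t, P ((\bigcap_(i in [set` J]) X i @^-1` `]-oo, t]) `&` E) =
    P (\bigcap_(i in [set` J]) X i @^-1` `]-oo, t]) * P E)%E ->
  (\int[P]_w (\1_E w * \big[Num.max/0]_(i <- J) X i w)%:E
   = P E * (harmonic_number R #|` J|)%:E)%E.
Proof.
move=> mE indE.
pose W w := \1_E w * \big[Num.max/0]_(i <- J) X i w.
have mW : measurable_fun [set: T] W.
  apply: measurable_funM; first exact: measurable_indic.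
  exact: measurable_bigmaxr.
pose Wf := mfun_Sub (mem_set mW) : {RV P >-> R}.
have max0 w : 0 <= \big[Num.max/0]_(i <- J) X i w by exact: bigmax_ge_id.
have W0 w : 0 <= Wf w by rewrite /= mulr_ge0// indicE.
transitivity ('E_P[Wf])%E; first by rewrite expectation_def.
rewrite ge0_expectation_ccdf//.
transitivity (\int[lebesgue_measure]_(t in `[0%R, +oo[)
    (P E * (1 - (1 - expR (- t)) ^+ #|` J|)%:E))%E.
  apply: eq_integral => t; rewrite inE/= in_itv/= andbT => t0.
  (* As [t >= 0], neither the value [0] taken off [E] nor the starting value [0] of the maximum can
     exceed [t]. *)
  have -> : ccdf Wf t = P (E `\` \bigcap_(i in [set` J]) X i @^-1` `]-oo, t]).
    rewrite /ccdf /distribution /pushforward; congr (P _).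
    apply/seteqP; split => w /=; rewrite in_itv/= andbT /W indicE.
      have [wE|wE] := boolP (w \in E); last by rewrite mul0r ltNge t0.
      rewrite mul1r => tW; split; first exact: set_mem.
      move=> Xt; move: tW; rewrite ltNge => /negP; apply.
      rewrite big_seq; apply: bigmax_le => [|i iJ]; first exact: t0.
      by have := Xt i iJ; rewrite /= in_itv.
    move=> [wE Xt]; rewrite mem_set// mul1r ltNge; apply/negP => le_t.
    apply: Xt => i /= iJ; rewrite in_itv/= (le_trans _ le_t)//.
    exact: (le_bigmax_seq _ i xpredT (X^~ w)).
  have mJ : measurable (\bigcap_(i in [set` J]) X i @^-1` `]-oo, t]).
    apply: fin_bigcap_measurable => // i _.
    by rewrite -[Y in measurable Y]setTI; apply: measurable_funPT => //; exact: measurable_itv.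
  rewrite measureD//; last by rewrite ltey_eq fin_num_measure.
  rewrite [X in (_ - X)%E](_ : _ =
      P (\bigcap_(i in [set` J]) X i @^-1` `]-oo, t]) * P E)%E; last first.
    by rewrite setIC; exact: indE.
  rewrite probability_exponential_le//.
  by rewrite EFinB muleBr ?fin_num_measure// mule1 muleC.
rewrite ge0_integralZl//; last 2 first.
- apply/measurable_EFinP; apply: measurable_funTS.
  apply: continuous_measurable_fun => t.
  by apply: cvgB; [exact: cvg_cst|exact: continuous_1subexpRX].
- move=> t /=; rewrite in_itv/= andbT => t0.
  have e1 : expR (- t) <= 1 by rewrite expR_le1 oppr_le0.
  by rewrite lee_fin subr_ge0 exprn_ile1// ?subr_ge0// gerBl expR_ge0.
by rewrite integral_1sub_1subX.
Qed.
End exponential_family.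

(** Splitting according to the value of [N] replaces a random index set by fixed ones, to which the
    previous lemma applies. *)
Lemma sum_indic_fiber {R : realType} {T : Type} {F : finType} (N : T -> F) (g : F -> R)
    (w : T) :
  \sum_A \1_(N @^-1` [set A]) w * g A = g (N w).
Proof.
rewrite (bigD1 (N w))//= big1 ?addr0.
  by rewrite indicE mem_set// mul1r.
move=> A /eqP AN; rewrite indicE memNset ?mul0r//=.
by move=> /= NA; apply: AN.
Qed.

(** * Comparison of the delay with service rank by rank *)

Section delay.
Context {R : realType} {k : nat} {d : measure_display} {T : measurableType d}
  (P : probability T R) (Q : 'I_k -> {RV P >-> nat})
  (X : nat * 'I_k -> {RV P >-> R}).
Hypothesis X_exp : forall ji (A : set R), measurable A ->
  distribution P (X ji) A = exponential_prob 1 A.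
Hypothesis X_ind : mutually_independent X.
Hypothesis XQ_ind : independent_families X Q.

Let N (j : nat) (w : T) : {set 'I_k} := [set i | (j <= Q i w)%N]%SET.
Let J (j : nat) (A : {set 'I_k}) : {fset nat * 'I_k} := [fset (j, i) | i in A]%fset.
(* The maximum is taken with [0] so that it is nonnegative for every outcome:
   the service times are nonnegative only almost surely. *)
Let max_on (j : nat) (A : {set 'I_k}) (w : T) : R :=
  \big[Num.max/0]_(ji <- J j A) X ji w.

Let measurable_N j A : measurable (N j @^-1` [set A]).
Proof.
(* The event is measurable because its real-valued indicator is a function of the queue lengths. *)
have := @measurable_nat_family _ _ T _ k Q (fun q => \1_[set A] [set i | (j <= q i)%N]%SET : R).
by move=> /measurable_indicP.
Qed.

Let ind_N j A t :
  (P ((\bigcap_(ji in [set` J j A]) X ji @^-1` `]-oo, t]) `&` N j @^-1` [set A]) =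
   P (\bigcap_(ji in [set` J j A]) X ji @^-1` `]-oo, t]) * P (N j @^-1` [set A]))%E.
Proof.
(* Membership of [i] in [N j] depends on [Q i] alone, so the event is an intersection of one
   condition per queue, the form to which [independent_families] applies. *)
have -> : N j @^-1` [set A] = \bigcap_(i in [set` [fset i | i in 'I_k]%fset])
    Q i @^-1` [set n | (j <= n)%N = (i \in A)].
  apply/seteqP; split => w /=.
    by move=> <- i _ /=; rewrite inE.
  by move=> NA; apply/setP => i; rewrite inE; apply: NA => /=; rewrite inE.
by apply: XQ_ind => // i; exact: measurable_itv.
Qed.

(** On the event that [N j] equals a fixed [A], which is independent of the service times, the
    maximum runs over [#|A|] i.i.d. exponentials and has mean [H(#|A|)]; summing over [A] gives both
    sides. *)
Lemma integral_max_of_long_queues (j : nat) :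
  (\int[P]_w (max_on j (N j w) w)%:E =
   \int[P]_w (harmonic_number R #|N j w|)%:E)%E.
Proof.
have cJ A : #|` J j A| = #|A|.
  rewrite card_imfset/=; last by move=> ? ? [].
  by rewrite -cardE.
transitivity (\int[P]_w \sum_A (\1_(N j @^-1` [set A]) w * max_on j A w)%:E)%E.
  apply: eq_integral => w _; rewrite sumEFin.
  by rewrite (sum_indic_fiber (N j) (fun A => max_on j A w)).
transitivity (\int[P]_w \sum_A (\1_(N j @^-1` [set A]) w * harmonic_number R #|A|)%:E)%E; last first.
  apply: eq_integral => w _; rewrite sumEFin.
  by rewrite (sum_indic_fiber (N j) (fun A => harmonic_number R #|A|)).
have H0 n : 0 <= harmonic_number R n by apply: sumr_ge0.
rewrite !ge0_integral_sum//.
- apply: eq_bigr => A _; rewrite integral_indic_max_exponential//; last exact: ind_N.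
  under [RHS]eq_integral do rewrite EFinM muleC.
  rewrite ge0_integralZl//; last by rewrite lee_fin H0.
    by rewrite integral_indic// setIT cJ muleC.
  by apply/measurable_EFinP; exact: measurable_indic.
- move=> A; apply/measurable_EFinP; exact: measurable_funM.
- by move=> A w _; rewrite lee_fin mulr_ge0// indicE.
- move=> A; apply/measurable_EFinP; apply: measurable_funM => //.
  exact: measurable_bigmaxr.
- move=> A w _; rewrite lee_fin mulr_ge0// ?indicE//.
  exact: bigmax_ge_id.
Qed.

Lemma mean_access_delay_le :
  (mean_access_delay Q X <=
   \int[P]_w \sum_(j <oo) (harmonic_number R #|N j w|)%:E)%E.
Proof.
have M0 j w : 0 <= max_on j (N j w) w by exact: bigmax_ge_id.
rewrite integral_nneseries//; last 2 first.
- move=> j; apply/measurable_EFinP.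
  exact: (@measurable_nat_family _ _ T _ k Q
    (fun q => harmonic_number R #|[set i | (j <= q i)%N]%SET|)).
- by move=> j w _; rewrite lee_fin sumr_ge0.
(* Each mean [H(c_j)] is traded for the maximum [M_j] inside the series; putting the series back
   under the integral leaves a comparison outcome by outcome. *)
under eq_eseriesr do rewrite -integral_max_of_long_queues.
rewrite -integral_nneseries//; last 2 first.
- move=> j; apply/measurable_EFinP.
  under eq_fun do rewrite -(sum_indic_fiber (N j) (fun A => max_on j A _)).
  apply: measurable_sum => A; apply: measurable_funM; first exact: measurable_indic.
  exact: measurable_bigmaxr.
- by move=> j w _; rewrite lee_fin.
apply: integral_le_ge0 => w; first by apply: nneseries_ge0 => j _ _; rewrite lee_fin.
apply: bigmax_le => [|i _]; first exact: leNye.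
rewrite -sumEFin.
(* The jobs of queue [i] have ranks [0] to [Q i w], hence the first [(Q i w).+1] terms of the
   series; for such [j], queue [i] belongs to [N j w]. *)
apply: le_trans (nneseries_lim_ge (Q i w).+1 _); last by move=> j _ _; rewrite lee_fin.
rewrite [leRHS]big_nat [leLHS]big_nat; apply: lee_sum => j /=; rewrite ltnS => jQ.
rewrite lee_fin /max_on; apply: (le_bigmax_seq _ (j, i) xpredT (X^~ w)) => //.
by rewrite in_imfset//= inE.
Qed.
End delay.

Theorem theorem6 (R : realType) (n k : nat) (lambda : R)
    (hk : (0 < k)%N) (hkn : (k < n)%N)
    (hnk : 1 < n%:R / k%:R :> R) (hnk2 : n%:R / k%:R < 2 :> R)
    (hlambda0 : 0 < lambda) (hlambda1 : lambda < 1)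
    (S : forall m : nat, batch_sampling R n k (n + m))
    (d : measure_display) (Omega : measurableType d) (P : probability Omega R)
    (Q : 'I_k -> {RV P >-> nat})
    (hQ : large_system_steady_state lambda S Q)
    (hQfin : forall i, ('E_P[fun w => (Q i w)%:R] < +oo)%E)
    (X : nat * 'I_k -> {RV P >-> R})
    (hXexp : forall ji (A : set R), measurable A ->
       distribution P (X ji) A = exponential_prob 1 A)
    (hXind : mutually_independent X)
    (hXQ : independent_families X Q) :
  (mean_access_delay Q X
     <= (harmonic_number R k)%:E
        + \sum_(1 <= l < k.+1)
            ((k - l + 1)%:R^-1)%:E
            * 'E_P[fun w => (order_stat (fun i => Q i w) l)%:R]
     <= (harmonic_number R k)%:E
        + \sum_(1 <= l < k.+1)
            'E_P[fun w => (order_stat (fun i => Q i w) l)%:R])%E.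
Proof.
have H0 m : 0 <= harmonic_number R m by apply: sumr_ge0.
have E0 l : (0 <= 'E_P[fun w => (order_stat (Q^~ w) l)%:R])%E.
  exact: expectation_ge0.
apply/andP; split; last first.
  (* The second inequality: the weights are at most [1] because [k - l + 1 >= 1], and the means are
     nonnegative. *)
  apply: leeD => //; apply: lee_sum => l _.
  rewrite -[leRHS]mul1e; apply: lee_wpmul2r; first exact: E0.
  by rewrite lee_fin invf_le1 ?ler1n ?ltr0n addn1.
apply: (le_trans (mean_access_delay_le _ _ _ hXexp hXind hXQ)).
(* What remains is linearity of the integral: the rank by rank comparison is the only loss in the
   first inequality. *)
under eq_integral do rewrite nneseries_harmonic_number.
have mE l : measurable_fun [set: Omega] (fun w => (order_stat (Q^~ w) l)%:R%:E : \bar R).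
  apply/measurable_EFinP.
  exact: (@measurable_nat_family _ _ _ _ k Q
    (fun q => (order_stat q l)%:R : R)).
rewrite ge0_integralD//; last 3 first.
- by move=> w _; rewrite lee_fin.
- by move=> w _; apply: sume_ge0 => l _; rewrite -EFinM lee_fin.
- by apply: emeasurable_sum => l; exact: measurable_funeM.
rewrite integral_cst// [X in (_ * X)%E]probability_setT mule1; apply: leeD => //.
rewrite ge0_integral_sum//; last first.
  by move=> l; exact: measurable_funeM.
under eq_bigr do rewrite ge0_integralZl ?lee_fin//.
by rewrite expectation.unlock.
Qed.
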